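(* A proper set system $S$ is a delta-matroid if and only if $S$ has no minor isomorphic to a set system in $\mathcal{S}\cup\mathcal{T}$.
   Context: A set system is a pair $S=(E,\mathcal{F})$ with $E$ a finite set and $\mathcal{F}$ a collection of subsets of $E$ (feasible sets); it is proper if $\mathcal{F}\neq\emptyset$. Set systems $(E,\mathcal{F})$, $(E',\mathcal{F}')$ are isomorphic if there is a bijection $\phi:E\to E'$ with $A\in\mathcal{F}\iff\phi(A)\in\mathcal{F}'$. For proper $S$ and $e\in E$: $e$ is a loop if no feasible set contains $e$, a coloop if every feasible set contains $e$. If $e$ is not a loop, $S/e=(E-e,\{F-e:e\in F\in\mathcal{F}\})$; if $e$ is not a coloop, $S\backslash e=(E-e,\{F\in\mathcal{F}:e\notin F\})$; if $e$ is a loop or coloop, $S/e$ and $S\backslash e$ are both set equal to whichever was defined. A minor of $S$ is any set system obtained from $S$ by a (possibly empty) sequence of such operations. For $A\subseteq E$, the twist is $S*A=(E,\{F\triangle A:F\in\mathcal{F}\})$. A delta-matroid is a proper set system such that for all $X,Y\in\mathcal{F}$ and $u\in X\triangle Y$ there is $v\in X\triangle Y$ (possibly $v=u$) with $X\triangle\{u,v\}\in\mathcal{F}$. For $i\ge1$, $S_i=(\{e_1,\ldots,e_i\},\{\emptyset,\{e_1,\ldots,e_i\}\})$, and $\mathcal{S}$ is the set of all twists of $S_3,S_4,\ldots$. Let $T_1=(\{a,b,c\},\{\emptyset,\{a,b\},\{a,b,c\}\})$; $T_2=(\{a,b,c\},\{\emptyset,\{a,b\},\{a,c\},\{a,b,c\}\})$;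 $T_3=(\{a,b,c\},\{\emptyset,\{a\},\{a,b\},\{a,b,c\}\})$; $T_4=(\{a,b,c\},\{\emptyset,\{a\},\{a,b\},\{a,c\},\{a,b,c\}\})$; $T_5=(\{a,b,c,d\},\{\emptyset,\{a,b\},\{a,b,c,d\}\})$; $T_6=(\{a,b,c,d\},\{\emptyset,\{a,b\},\{a,c\},\{a,b,c,d\}\})$; $T_7=(\{a,b,c,d\},\{\emptyset,\{a,b\},\{a,c\},\{a,d\},\{a,b,c,d\}\})$; $T_8=(\{a,b,c,d\},\{\emptyset,\{a\},\{a,b\},\{a,c\},\{a,d\},\{a,b,c,d\}\})$. $\mathcal{T}$ is the set of all twists of $T_1,\ldots,T_8$. *)

(* Defs.v *)
From mathcomp Require Import all_boot.

Set Implicit Arguments.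
Unset Strict Implicit.
Unset Printing Implicit Defensive.

(* The ground set is a subset of an ambient finite type, so that the systems
   obtained by deleting elements live over the same type. *)
Record set_system (T : finType) := SetSystem {
  ground : {set T};
  feasible : {set {set T}};
  feasible_powerset : feasible \subset powerset ground
}.

Definition symdiff (T : finType) (A B : {set T}) : {set T} :=
  (A :\: B) :|: (B :\: A).

Section SetSystems.

Variable T : finType.
Implicit Types (S N : set_system T) (A : {set T}) (e : T).

Definition proper_system S : Prop := feasible S <> set0.

Definition loop S e : bool := [forall F in feasible S, e \notin F].

Definition coloop S e : bool := [forall F in feasible S, e \in F].

Fact avoiding_subproof S e :
  [set F in feasible S | e \notin F] \subset powerset (ground S :\ e).
Proof.
apply/subsetP => F; rewrite inE => /andP[FS eF].
have := subsetP (feasible_powerset S) F FS.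
by rewrite !powersetE subsetD1 eF andbT.
Qed.

Definition avoiding S e : set_system T := SetSystem (avoiding_subproof S e).

Fact containing_subproof S e :
  [set F :\ e | F in feasible S & e \in F] \subset powerset (ground S :\ e).
Proof.
apply/subsetP => B /imsetP[F]; rewrite inE => /andP[FS _] ->.
have := subsetP (feasible_powerset S) F FS.
by rewrite !powersetE; apply: setSD.
Qed.

Definition containing S e : set_system T := SetSystem (containing_subproof S e).

(* The set system S / e. *)
Definition contraction S e : set_system T :=
  if loop S e then avoiding S e else containing S e.

(* The set system S \ e. *)
Definition deletion S e : set_system T :=
  if coloop S e then containing S e else avoiding S e.

Inductive minor S : set_system T -> Prop :=
| minor_refl : minor S S
| minor_contraction N e :
    minor S N -> e \in ground N -> minor S (contraction N e)
| minor_deletion N e :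
    minor S N -> e \in ground N -> minor S (deletion N e).

Fact twist_subproof S A : A \subset ground S ->
  [set symdiff F A | F in feasible S] \subset powerset (ground S).
Proof.
move=> sAS; apply/subsetP => _ /imsetP[F FS ->].
have := subsetP (feasible_powerset S) F FS.
rewrite !powersetE => sFS; rewrite subUset.
by rewrite (subset_trans (subsetDl _ _) sFS) (subset_trans (subsetDl _ _) sAS).
Qed.

Definition twist S A (sAS : A \subset ground S) : set_system T :=
  SetSystem (twist_subproof sAS).

Definition delta_matroid S : Prop :=
  proper_system S /\
  forall X Y u, X \in feasible S -> Y \in feasible S -> u \in symdiff X Y ->
  exists2 v, v \in symdiff X Y & symdiff X [set u; v] \in feasible S.

Fact full_subproof (F : {set {set T}}) : F \subset powerset [set: T].
Proof. by apply/subsetP => X _; rewrite powersetE subsetT. Qed.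

Definition full_system (F : {set {set T}}) : set_system T :=
  SetSystem (full_subproof F).

End SetSystems.

(* A bijection between the ground sets is a bijection between the associated
   subtypes; a subset of the ground set is the image under val of a set over
   the subtype. *)
Definition isomorphic (T T' : finType)
    (S : set_system T) (S' : set_system T') : Prop :=
  exists2 phi : {x | x \in ground S} -> {y | y \in ground S'}, bijective phi &
    forall A : {set {x | x \in ground S}},
      ([set val x | x in A] \in feasible S) =
      ([set val (phi x) | x in A] \in feasible S').

Definition S_ (i : nat) : set_system 'I_i := full_system [set set0; setT].

Inductive in_calS : forall n, set_system 'I_n -> Prop :=
| InCalS i (A : {set 'I_i}) (sA : A \subset ground (S_ i)) :
    3 <= i -> in_calS (twist sA).

Section ThreeElements.

Let a : 'I_3 := @Ordinal 3 0 isT.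
Let b : 'I_3 := @Ordinal 3 1 isT.
Let c : 'I_3 := @Ordinal 3 2 isT.

Definition T1 : set_system 'I_3 :=
  full_system [set set0; [set a; b]; [set a; b; c]].
Definition T2 : set_system 'I_3 :=
  full_system [set set0; [set a; b]; [set a; c]; [set a; b; c]].
Definition T3 : set_system 'I_3 :=
  full_system [set set0; [set a]; [set a; b]; [set a; b; c]].
Definition T4 : set_system 'I_3 :=
  full_system [set set0; [set a]; [set a; b]; [set a; c]; [set a; b; c]].

End ThreeElements.

Section FourElements.

Let a : 'I_4 := @Ordinal 4 0 isT.
Let b : 'I_4 := @Ordinal 4 1 isT.
Let c : 'I_4 := @Ordinal 4 2 isT.
Let d : 'I_4 := @Ordinal 4 3 isT.

Definition T5 : set_system 'I_4 :=
  full_system [set set0; [set a; b]; [set a; b; c; d]].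
Definition T6 : set_system 'I_4 :=
  full_system [set set0; [set a; b]; [set a; c]; [set a; b; c; d]].
Definition T7 : set_system 'I_4 :=
  full_system
    [set set0; [set a; b]; [set a; c]; [set a; d]; [set a; b; c; d]].
Definition T8 : set_system 'I_4 :=
  full_system
    [set set0; [set a]; [set a; b]; [set a; c]; [set a; d]; [set a; b; c; d]].

End FourElements.

Inductive in_calT : forall n, set_system 'I_n -> Prop :=
| InCalT1 (A : {set 'I_3}) (sA : A \subset ground T1) : in_calT (twist sA)
| InCalT2 (A : {set 'I_3}) (sA : A \subset ground T2) : in_calT (twist sA)
| InCalT3 (A : {set 'I_3}) (sA : A \subset ground T3) : in_calT (twist sA)
| InCalT4 (A : {set 'I_3}) (sA : A \subset ground T4) : in_calT (twist sA)
| InCalT5 (A : {set 'I_4}) (sA : A \subset ground T5) : in_calT (twist sA)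
| InCalT6 (A : {set 'I_4}) (sA : A \subset ground T6) : in_calT (twist sA)
| InCalT7 (A : {set 'I_4}) (sA : A \subset ground T7) : in_calT (twist sA)
| InCalT8 (A : {set 'I_4}) (sA : A \subset ground T8) : in_calT (twist sA).

(* Main.v *)
(**
The minors of S are the nonempty restrictions of its feasible sets to subcubes,
and twisting commutes with restricting, so one may normalize a failure of the
exchange axiom. Choose a failing triple (X, Y, u) with the symmetric difference
D of X and Y as small as possible, restrict to the subcube between X and Y, and
twist so that X becomes the empty set and Y becomes D. By minimality, D is the
only feasible set containing u; and if Z is another nonempty feasible set, then
exchanging from Z towards D at u gives |D - Z| <= 2, while exchanging from the
empty set towards Z gives a feasible set with at most two elements. Hence either
the only feasible sets are the empty set and D, a member of S_3, S_4, ..., or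
|D| <= 4 and the few remaining cases are twists of T_1, ..., T_8.
*)
Require Import Defs.
From mathcomp Require Import all_boot.

Set Implicit Arguments.
Unset Strict Implicit.
Unset Printing Implicit Defensive.

(** * Algebra of symmetric differences *)

Section SymmetricDifference.

Variable T : finType.
Implicit Types A B C : {set T}.

Lemma in_symdiff A B x : (x \in symdiff A B) = (x \in A) (+) (x \in B).
Proof. by rewrite !inE; case: (x \in A); case: (x \in B). Qed.

Lemma symdiffC A B : symdiff A B = symdiff B A.
Proof. by rewrite /symdiff setUC. Qed.

Lemma symdiffA A B C : symdiff A (symdiff B C) = symdiff (symdiff A B) C.
Proof. by apply/setP => x; rewrite !in_symdiff addbA. Qed.

Lemma symdiff0 A : symdiff A set0 = A.
Proof. by apply/setP => x; rewrite in_symdiff inE addbF. Qed.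

Lemma symdiffK A B : symdiff (symdiff A B) B = A.
Proof. by apply/setP => x; rewrite !in_symdiff addbK. Qed.

Lemma symdiffKl A B : symdiff A (symdiff A B) = B.
Proof. by apply/setP => x; rewrite !in_symdiff addKb. Qed.

End SymmetricDifference.

Lemma imset_symdiff (T T' : finType) (g : T -> T') (A B : {set T}) :
  injective g -> g @: symdiff A B = symdiff (g @: A) (g @: B).
Proof.
move=> inj_g; apply/setP=> y; rewrite in_symdiff.
case: (boolP (y \in codom g)) => [/codomP[x ->]|].
  by rewrite !mem_imset // in_symdiff.
move=> yg; suff notin (C : {set T}) : (y \in g @: C) = false by rewrite !notin.
by apply: contraNF yg => /imsetP[x _ ->]; apply: codom_f.
Qed.

(** * Exchange in minors, and minors as restrictions to subcubes *)

Section Minors.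

Variable T : finType.
Implicit Types (S N : set_system T) (A B D X Y F : {set T}) (e : T).

Definition exchange S := forall X Y u,
  X \in feasible S -> Y \in feasible S -> u \in symdiff X Y ->
  exists2 v, v \in symdiff X Y & symdiff X [set u; v] \in feasible S.

Lemma feasible_sub S F : F \in feasible S -> F \subset ground S.
Proof. by move/(subsetP (feasible_powerset S)); rewrite powersetE. Qed.

Lemma in_avoiding S e B :
  (B \in feasible (avoiding S e)) = (e \notin B) && (B \in feasible S).
Proof. by rewrite inE andbC. Qed.

Lemma in_containing S e B :
  (B \in feasible (containing S e)) = (e \notin B) && (e |: B \in feasible S).
Proof.
apply/imsetP/andP => [[F] | [eB BS]].
  rewrite inE => /andP[FS eF] ->; rewrite !inE eqxx; split=> //.
  by rewrite setD1K.
by exists (e |: B); rewrite ?setU1K // inE BS setU11.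
Qed.

(** Both [X] and [Y] omit [e], so neither [u] nor [v] can be [e], and the exchanged set omits [e] as
    well. *)
Lemma exchange_avoiding S e : exchange S -> exchange (avoiding S e).
Proof.
move=> exS X Y u; rewrite !in_avoiding => /andP[eX XS] /andP[eY YS] uXY.
have [v vXY vS] := exS _ _ _ XS YS uXY; exists v => //.
rewrite in_avoiding vS andbT in_symdiff (negPf eX) /= !inE negb_or.
by apply/andP; split; apply/eqP => eE;
  [move: uXY | move: vXY]; rewrite -eE in_symdiff (negPf eX) (negPf eY).
Qed.

(** Adding [e] to both sets leaves their symmetric difference unchanged, so an exchange in [S]
    transfers directly. *)
Lemma exchange_containing S e : exchange S -> exchange (containing S e).
Proof.
move=> exS X Y u; rewrite !in_containing => /andP[eX XS] /andP[eY YS] uXY.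
have dE : symdiff (e |: X) (e |: Y) = symdiff X Y.
  apply/setP=> x; rewrite !in_symdiff !inE.
  by case: eqP => // ->; rewrite (negPf eX) (negPf eY).
have [|v] := exS _ _ u XS YS; rewrite dE // => vXY vS; exists v => //.
have neq w : w \in symdiff X Y -> (w == e) = false.
  move=> wXY; apply: contraTF wXY => /eqP->.
  by rewrite in_symdiff (negPf eX) (negPf eY).
rewrite in_containing in_symdiff (negPf eX) /= !inE.
rewrite eq_sym neq // eq_sym neq //=.
suff -> : e |: symdiff X [set u; v] = symdiff (e |: X) [set u; v] by [].
apply/setP=> x; rewrite in_setU1 !in_symdiff !inE.
by case: (x =P e) => // ->; rewrite eq_sym neq // eq_sym neq.
Qed.

Lemma exchange_minor S N : exchange S -> minor S N -> exchange N.
Proof.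
move=> exS; elim=> // {}N e _ exN _.
  rewrite /contraction; case: ifP => _; first exact: exchange_avoiding.
  exact: exchange_containing.
rewrite /deletion; case: ifP => _; first exact: exchange_containing.
exact: exchange_avoiding.
Qed.

(** Elements outside [D] are removed one at a time: those in [X] are contracted, the others are
    deleted. *)
Lemma minor_restriction S X D :
  X \in feasible S -> D \subset ground S ->
  exists N, [/\ minor S N, ground N = D &
    forall B, (B \in feasible N) =
      (B \subset D) && (B :|: (X :\: D) \in feasible S)].
Proof.
move=> XS; have [n] := ubnP #|ground S :\: D|.
elim: n D => // n IHn D; rewrite ltnS => leDn sDS.
have [/eqP|[e]] := set_0Vmem (ground S :\: D).
  rewrite setD_eq0 => sSD; exists S.
  have gS : ground S = D by apply/eqP; rewrite eqEsubset sSD.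
  split=> [|//|B]; first exact: minor_refl.
  have -> : X :\: D = set0 by apply/eqP; rewrite setD_eq0 -gS feasible_sub.
  by rewrite setU0; case: (boolP (B \in _)) => [/feasible_sub|];
    rewrite ?andbF // gS => ->.
rewrite inE => /andP[eD eS].
have [||N [minN gN fN]] := IHn (e |: D).
- apply: leq_trans leDn; apply/proper_card/properP; split.
    by apply: setDS; exact: subsetUr.
  by exists e; rewrite ?inE ?eqxx ?eD.
- by rewrite subUset sub1set eS.
have eN : e \in ground N by rewrite gN setU11.
(* This feasible set contains [e] exactly when [X] does. It shows that [e] is not a loop when it is
   contracted and not a coloop when it is deleted, so each operation takes its regular form. *)
have XN : X :&: (e |: D) \in feasible N.
  by rewrite fN subsetIr setID.
case: (boolP (e \in X)) => eX.
- exists (contraction N e); split; first exact: minor_contraction.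
    by rewrite /contraction; case: ifP => _ /=; rewrite gN setU1K.
  move=> B; have -> : contraction N e = containing N e.
    rewrite /contraction ifN //; apply/forall_inPn.
    by exists (X :&: (e |: D)); rewrite // !inE eX eqxx.
  rewrite in_containing fN subUset sub1set setU11 /= andbA.
  have [eB|eB] /= := boolP (e \in B).
    suff /negPf-> : ~~ (B \subset D) by [].
    by apply: contra eD => /subsetP->.
  have -> : (B \subset D) = (B \subset e |: D).
    by rewrite -{1}(setU1K eD) subsetD1 eB andbT.
  suff -> : e |: B :|: X :\: (e |: D) = B :|: X :\: D by [].
  apply/setP=> x; rewrite !inE; case: eqP => // ->.
  by rewrite eX eD orbT.
exists (deletion N e); split; first exact: minor_deletion.
  by rewrite /deletion; case: ifP => _ /=; rewrite gN setU1K.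
move=> B; have -> : deletion N e = avoiding N e.
  rewrite /deletion ifN //; apply/forall_inPn.
  by exists (X :&: (e |: D)); rewrite // !inE (negPf eX).
rewrite in_avoiding fN /= andbA.
have -> : (B \subset D) = (e \notin B) && (B \subset e |: D).
  by rewrite -{1}(setU1K eD) subsetD1 andbC.
suff -> : X :\: (e |: D) = X :\: D by [].
apply/setP=> x; rewrite !inE; case: eqP => // ->.
by rewrite (negPf eX) eD.
Qed.

End Minors.

(** * Isomorphisms with systems on ordinals *)

Section Isomorphisms.

Variables (T : finType) (n : nat).
Implicit Types (N : set_system T) (M : set_system 'I_n).

(** Replaces a bijection between subtypes by an injection from the ordinals, so that later arguments
    handle only images of sets. *)
Lemma isomorphic_parametrization N M : ground M = setT ->
  isomorphic N M <->
  exists g : 'I_n -> T, [/\ injective g, g @: setT = ground N &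
    forall C, (C \in feasible M) = (g @: C \in feasible N)].
Proof.
move=> gM; have inM i : i \in ground M by rewrite gM inE.
split=> [[phi [psi phiK psiK] phiF] | [g [inj_g gN gF]]].
  exists (fun i => val (psi (Sub i (inM i)))); split.
  - move=> i j /val_inj/(can_inj psiK)/(congr1 val).
    by rewrite !SubK.
  - apply/setP=> x; apply/imsetP/idP => [[i _ ->]|xN]; first exact: valP.
    exists (val (phi (Sub x xN))); rewrite ?inE //.
    rewrite (_ : Sub _ _ = phi (Sub x xN)) ?phiK //.
    exact: val_inj.
  move=> C; pose B := [set psi (Sub i (inM i)) | i in C].
  have <- : [set val x | x in B] = [set val (psi (Sub i (inM i))) | i in C].
    by rewrite -imset_comp.
  suff {1}-> : C = [set val (phi x) | x in B] by rewrite phiF.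
  rewrite -imset_comp -[LHS]imset_id; apply: eq_imset => i.
  by rewrite /= psiK.
have memN i : g i \in ground N by rewrite -gN imset_f ?inE.
have ex_i (x : {x | x \in ground N}) : exists i, g i == val x.
  by case: x => x /=; rewrite -gN => /imsetP[i _ ->]; exists i.
pose f x : {y | y \in ground M} := Sub (xchoose (ex_i x)) (inM _).
have fK x : g (val (f x)) = val x by apply/eqP/(xchooseP (ex_i x)).
exists f.
  exists (fun y => Sub (g (val y)) (memN _)) => [x|y]; apply: val_inj.
    exact: fK.
  by apply: inj_g; rewrite fK.
move=> A; rewrite gF -imset_comp.
suff /eq_imset-> : g \o (fun x => val (f x)) =1 val by [].
exact: fK.
Qed.

Lemma exchange_isomorphic N M :
  ground M = setT -> isomorphic N M -> exchange N -> exchange M.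
Proof.
move=> gM /(isomorphic_parametrization N gM)[g [inj_g _ gF]] exN X Y u.
rewrite !gF => XN YN uXY.
have [|v] := exN _ _ (g u) XN YN; rewrite -imset_symdiff ?mem_imset //.
move=> /imsetP[{}v vXY ->] vN; exists v => //.
by rewrite gF imset_symdiff // imsetU1 imset_set1.
Qed.

End Isomorphisms.

(** * Twists and the exchange axiom *)

Section Twists.

Variable T : finType.
Implicit Types (S : set_system T) (A B : {set T}).

Lemma in_twist S A (sA : A \subset ground S) B :
  (B \in feasible (twist sA)) = (symdiff B A \in feasible S).
Proof.
apply/imsetP/idP => [[F FS ->]|BS]; first by rewrite symdiffK.
by exists (symdiff B A); rewrite ?symdiffK.
Qed.

(** Twisting [X] and [Y] by [A] preserves their symmetric difference. Refuting exchange for a twist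
    thus reduces to refuting it for the untwisted system. *)
Lemma exchange_twist S A (sA : A \subset ground S) :
  exchange (twist sA) -> exchange S.
Proof.
move=> exS X Y u XS YS.
have dE : symdiff X Y = symdiff (symdiff X A) (symdiff Y A).
  by apply/setP=> x; rewrite !in_symdiff; do 3!case: (x \in _).
have := exS (symdiff X A) (symdiff Y A) u.
rewrite !in_twist !symdiffK -dE => /(_ XS YS) exu /exu[v vXY].
rewrite in_twist => vS; exists v => //.
suff <- : symdiff (symdiff (symdiff X A) [set u; v]) A =
  symdiff X [set u; v] by [].
by apply/setP=> x; rewrite !in_symdiff; do 3!case: (x \in _).
Qed.

End Twists.

Definition has_excluded_minor (T : finType) (S : set_system T) : Prop :=
  exists (N : set_system T) (n : nat) (M : set_system 'I_n),
    [/\ minor S N, in_calS M \/ in_calT M & isomorphic N M].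

(** * Realizing patterns as twisted minors *)

Section Realization.

Variables (T : finType) (S : set_system T) (n : nat) (M : set_system 'I_n).
Hypotheses (gM : ground M = setT) (M0 : set0 \in feasible M).

(** Restrict [S] at [X] to the image of [g]. The pattern [M] measures feasible sets by their
    displacement from [X], and the twist by the preimage of [X] turns displacements back into
    sets. *)
Lemma twist_minor (X : {set T}) (g : 'I_n -> T) :
  injective g -> g @: setT \subset ground S ->
  (forall C, (C \in feasible M) = (symdiff X (g @: C) \in feasible S)) ->
  exists N (A : {set 'I_n}) (sA : A \subset ground M),
    minor S N /\ isomorphic N (twist sA).
Proof.
move=> inj_g gS gF.
have XS : X \in feasible S by rewrite -(symdiff0 X) -(imset0 g) -gF.
have [N [minN gN fN]] := minor_restriction XS gS.
have sA : g @^-1: X \subset ground M by rewrite gM subsetT.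
exists N, (g @^-1: X), sA; split=> //; apply/isomorphic_parametrization => //.
exists g; split=> // C.
rewrite in_twist fN imsetS ?subsetT // gF imset_symdiff //.
suff -> : symdiff X (symdiff (g @: C) (g @: (g @^-1: X))) =
  g @: C :|: X :\: g @: setT by [].
apply/setP=> x; rewrite !in_symdiff !inE.
case: (boolP (x \in g @: setT)) => [/imsetP[i _ ->]|xg].
  by rewrite !mem_imset // !inE; case: (i \in C); case: (g i \in X).
have notin (B : {set 'I_n}) : (x \in g @: B) = false.
  by apply: contraNF xg => /imsetP[i _ ->]; rewrite imset_f.
by rewrite !notin /= addbF.
Qed.

(** Patterns are tested on masks of explicit lists, which compute; this links masks to images. *)
Lemma tuple_mask (s : n.-tuple T) (a : pred 'I_n) :
  [set x in mask [seq a i | i <- enum 'I_n] s] = tnth s @: [set i | a i].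
Proof.
rewrite -{1}(map_tnth_enum s) -map_mask -filter_mask.
apply/setP=> x; rewrite inE; apply/mapP/imsetP => -[i iA ->]; exists i => //.
  by move: iA; rewrite mem_filter inE => /andP[].
by move: iA; rewrite mem_filter inE mem_enum andbT.
Qed.

(* The flag t twists the pattern M by its whole ground set. *)
Lemma pattern_excluded (X : {set T}) (s : n.-tuple T) (t : bool) :
  (forall (A : {set 'I_n}) (sA : A \subset ground M), in_calT (twist sA)) ->
  uniq s -> all (mem (ground S)) s ->
  (forall C, (C \in feasible M) = (symdiff X
    [set x in mask [seq (i \in C) (+) t | i <- enum 'I_n] s] \in feasible S)) ->
  has_excluded_minor S.
Proof.
move=> inT /tuple_uniqP inj_s /allP sS fM.
(* [E] is everything or nothing according to [t]. Complementing the mask amounts to moving the base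
   point from [X] to its symmetric difference with the image of [E]. *)
pose E : {set 'I_n} := [set i | t].
have [|| N [A [sA [minN isoN]]]] :=
    @twist_minor (symdiff X (tnth s @: E)) (tnth s) inj_s.
- by apply/subsetP=> _ /imsetP[i _ ->]; apply: sS; apply: mem_tnth.
- move=> C; rewrite fM tuple_mask -symdiffA -imset_symdiff //.
  suff -> : [set i | (i \in C) (+) t] = symdiff E C by [].
  by apply/setP=> i; rewrite in_symdiff !inE addbC.
by exists N, n, (twist sA); split=> //; right.
Qed.

End Realization.

(** * The excluded systems violate exchange *)

Lemma set_ordE n (C D : {set 'I_n}) :
  (C == D) = all (fun i => (i \in C) == (i \in D)) (enum 'I_n).
Proof.
apply/eqP/allP => [-> //|eqCD]; apply/setP=> i.
by apply/eqP/eqCD; rewrite mem_enum.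
Qed.

Local Notation "#3 k" := (@Ordinal 3 k isT) (at level 8, k at level 2).
Local Notation "#4 k" := (@Ordinal 4 k isT) (at level 8, k at level 2).

Lemma enum_I3 : enum 'I_3 = [:: #3 0; #3 1; #3 2].
Proof. by apply: (inj_map val_inj); rewrite val_enum_ord. Qed.

Lemma enum_I4 : enum 'I_4 = [:: #4 0; #4 1; #4 2; #4 3].
Proof. by apply: (inj_map val_inj); rewrite val_enum_ord. Qed.

Ltac decide_feasible :=
  by rewrite /= ?inE ?set_ordE ?enum_I3 ?enum_I4 /= ?in_symdiff ?inE.

Lemma exchange_fails (T : finType) (S : set_system T) (X Y : {set T}) u :
  X \in feasible S -> Y \in feasible S -> u \in symdiff X Y ->
  (forall v, symdiff X [set u; v] \notin feasible S) -> ~ exchange S.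
Proof. by move=> XS YS uXY noS /(_ X Y u XS YS uXY)[v _]; apply/negP. Qed.

(** An exchange from the empty set towards the whole ground set produces a nonempty set of at most
    two elements, while the ground set has at least three. *)
Lemma calS_not_exchange n (M : set_system 'I_n) : in_calS M -> ~ exchange M.
Proof.
case=> {n M} i A sA lt2i /exchange_twist.
have lt0i : 0 < i by apply: leq_trans lt2i.
apply: (@exchange_fails _ _ set0 setT (Ordinal lt0i)).
- by rewrite !inE eqxx.
- by rewrite !inE eqxx orbT.
- by rewrite in_symdiff !inE.
move=> v; rewrite symdiffC symdiff0 !inE negb_or.
rewrite -cards_eq0 eqEcard subsetT cardsT card_ord cards2 -ltnNge.
by rewrite (leq_trans _ lt2i) //; case: (_ != v).
Qed.

Lemma calT_not_exchange n (M : set_system 'I_n) : in_calT M -> ~ exchange M.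
Proof.
have fails3 (S : set_system 'I_3) X Y u :
    X \in feasible S -> Y \in feasible S -> u \in symdiff X Y ->
    all (fun v => symdiff X [set u; v] \notin feasible S)
      [:: #3 0; #3 1; #3 2] -> ~ exchange S.
  move=> XS YS uXY /allP noS; apply: exchange_fails XS YS uXY _ => v.
  by apply: noS; rewrite -enum_I3 mem_enum.
have fails4 (S : set_system 'I_4) X Y u :
    X \in feasible S -> Y \in feasible S -> u \in symdiff X Y ->
    all (fun v => symdiff X [set u; v] \notin feasible S)
      [:: #4 0; #4 1; #4 2; #4 3] -> ~ exchange S.
  move=> XS YS uXY /allP noS; apply: exchange_fails XS YS uXY _ => v.
  by apply: noS; rewrite -enum_I4 mem_enum.
(* For [T1], [T3], [T5] and [T6], the whole set is the only feasible set containing the chosen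
   element. For [T2], [T4], [T7] and [T8], the empty set is the only feasible set avoiding [a]. A
   change of at most two elements reaches neither. *)
case=> {n M} A sA /exchange_twist; [
  apply: (fails3 _ set0 setT #3 2) | apply: (fails3 _ setT set0 #3 0) |
  apply: (fails3 _ set0 setT #3 2) | apply: (fails3 _ setT set0 #3 0) |
  apply: (fails4 _ set0 setT #4 2) | apply: (fails4 _ set0 setT #4 3) |
  apply: (fails4 _ setT set0 #4 0) | apply: (fails4 _ setT set0 #4 0)].
all: by decide_feasible.
Qed.

Lemma exchange_no_excluded_minor (T : finType) (S : set_system T) :
  exchange S -> ~ has_excluded_minor S.
Proof.
move=> exS [N [n [M [minN exclM isoN]]]].
have gM : ground M = setT by case: exclM => -[].
have exM := exchange_isomorphic gM isoN (exchange_minor exS minN).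
by case: exclM => [/calS_not_exchange|/calT_not_exchange].
Qed.

(** * Recognizing patterns on three or four elements *)

Section FewElements.

Variables (T : finType) (S : set_system T) (X : {set T}).

(** Displacements from [X] are given as lists, so that known values can be looked up regardless of
    order and repetition. *)
Let f (s : seq T) := symdiff X [set x in s] \in feasible S.

Lemma shift_feasible_eq s s' b : f s = b -> s =i s' -> b = f s'.
Proof.
rewrite /f => <- eqs; suff -> : [set x in s] = [set x in s'] by [].
by apply/setP=> x; rewrite !inE.
Qed.

Ltac lookup :=
  match goal with H : _ |- _ =>
    by apply: (@shift_feasible_eq _ _ _ H) => ?; rewrite ?inE;
      do ?case: (_ == _)
  end.

(** Runs through all subsets [C] of the three or four ordinals and settles each by a recorded value
    of [f]. *)
Ltac match_pattern :=
  move=> ?; rewrite ?enum_I3 ?enum_I4 /= ?inE ?set_ordE;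
  rewrite ?enum_I3 ?enum_I4 /= ?inE /=;
  do ?[case: (#3 0 \in _) | case: (#3 1 \in _) | case: (#3 2 \in _) |
       case: (#4 0 \in _) | case: (#4 1 \in _) | case: (#4 2 \in _) |
       case: (#4 3 \in _)] => /=;
  lookup.

(** The tuple [s] decides which elements play the roles of [a], [b], [c], [d], whereas distinctness
    is known for the order [s']. *)
Lemma pattern_excluded_eq_mem n (M : set_system 'I_n)
    (s : n.-tuple T) (s' : seq T) t :
  (forall (A : {set 'I_n}) (sA : A \subset ground M), in_calT (twist sA)) ->
  ground M = setT -> set0 \in feasible M -> s =i s' -> size s' = n ->
  (forall C, (C \in feasible M) = (symdiff X
    [set x in mask [seq (i \in C) (+) t | i <- enum 'I_n] s] \in feasible S)) ->
  uniq s' -> all (mem (ground S)) s' -> has_excluded_minor S.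
Proof.
move=> inT gM M0 eqs sz_s' fM; rewrite -(eq_all_r eqs).
rewrite -(eq_uniq _ eqs) ?size_tuple // => uniq_s sS.
exact: pattern_excluded gM M0 _ _ _ inT uniq_s sS fM.
Qed.

Ltac realize s t inT :=
  apply: (@pattern_excluded_eq_mem _ _ s _ t inT); [
    by [] |
    by rewrite !inE eqxx |
    by move=> ?; rewrite !inE; do ?case: (_ == _) |
    by [] |
    match_pattern].

(** Only the three nonempty displacements avoiding [u] are undetermined. Their seven admissible
    combinations give [T1] to [T4], up to swapping [p] and [q] and complementing. *)
Lemma three_elements u p q :
  uniq [:: u; p; q] -> all (mem (ground S)) [:: u; p; q] ->
  f [::] -> f [:: u; p; q] -> ~~ f [:: u] -> ~~ f [:: u; p] -> ~~ f [:: u; q] ->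
  [|| f [:: p], f [:: q] | f [:: p; q]] -> has_excluded_minor S.
Proof.
move=> uniq_s all_s f0 fupq /negPf fu /negPf fup /negPf fuq.
case fp : (f [:: p]); case fq : (f [:: q]); case fpq : (f [:: p; q]) => // _;
  move: uniq_s all_s.
- realize [tuple u; p; q] true InCalT4.
- realize [tuple u; p; q] true InCalT2.
- realize [tuple p; q; u] false InCalT3.
- realize [tuple u; q; p] true InCalT1.
- realize [tuple q; p; u] false InCalT3.
- realize [tuple u; p; q] true InCalT1.
- realize [tuple p; q; u] false InCalT1.
Qed.

(** Only [{p, r}], [{q, r}] and [{p, q, r}] are undetermined, and the triple forces both pairs. The
    five remaining combinations give [T5] to [T8], with [T6] occurring twice. *)
Lemma four_elements u p q r :
  uniq [:: u; p; q; r] -> all (mem (ground S)) [:: u; p; q; r] ->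
  f [::] -> f [:: u; p; q; r] ->
  ~~ f [:: u] -> ~~ f [:: u; p] -> ~~ f [:: u; q] -> ~~ f [:: u; r] ->
  ~~ f [:: u; p; q] -> ~~ f [:: u; p; r] -> ~~ f [:: u; q; r] ->
  ~~ f [:: p] -> ~~ f [:: q] -> ~~ f [:: r] ->
  f [:: p; q] -> (f [:: p; q; r] -> f [:: p; r] && f [:: q; r]) ->
  has_excluded_minor S.
Proof.
move=> uniq_s all_s f0 fupqr /negPf fu /negPf fup /negPf fuq /negPf fur.
move=> /negPf fupq /negPf fupr /negPf fuqr /negPf fp /negPf fq /negPf fr fpq.
case fpqr: (f [:: p; q; r]); case fpr: (f [:: p; r]); case fqr: (f [:: q; r]);
  move=> // edges; try by have := edges isT.
all: move: uniq_s all_s => {edges}.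
- realize [tuple u; p; q; r] true InCalT8.
- realize [tuple u; p; q; r] true InCalT7.
- realize [tuple p; q; r; u] false InCalT6.
- realize [tuple q; p; r; u] false InCalT6.
- realize [tuple p; q; r; u] false InCalT5.
Qed.

End FewElements.

(** * From a minimal failure to an excluded minor *)

Lemma only_two_feasible (T : finType) (S : set_system T) (X D : {set T}) :
  D \subset ground S -> 2 < #|D| ->
  (forall Z : {set T}, Z \subset D ->
    (symdiff X Z \in feasible S) = (Z == set0) || (Z == D)) ->
  has_excluded_minor S.
Proof.
move=> sDS lt2D fZ; pose g := @enum_val T (mem D).
have gT : g @: setT = D.
  apply/setP=> x; apply/imsetP/idP => [[i _ ->]|xD]; first exact: enum_valP.
  by exists (enum_rank_in xD x); rewrite // /g enum_rankK_in.
have inj_g : injective g by apply: enum_val_inj.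
have [||||N [A [sA [minN isoN]]]] :=
    @twist_minor T S #|D| (S_ #|D|) _ _ X g inj_g.
- by [].
- by rewrite !inE eqxx.
- by rewrite gT.
- move=> C; have := imsetS g (subsetT C); rewrite gT => /fZ->.
  by rewrite !inE imset_eq0 -[C == setT](inj_eq (imset_inj inj_g)) gT.
by exists N, #|D|, (twist sA); split=> //; left; apply: InCalS.
Qed.

(* Feasible sets are recorded through P by their symmetric difference with X. *)
Lemma minimal_failure_excluded (T : finType) (S : set_system T)
    (X D : {set T}) u (P := fun Z : {set T} => symdiff X Z \in feasible S) :
  D \subset ground S -> P set0 -> P D -> u \in D ->
  (forall v, v \in D -> ~~ P [set u; v]) ->
  (forall Z W w, P Z -> P W -> #|symdiff Z W| < #|D| -> w \in symdiff Z W ->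
    exists2 v, v \in symdiff Z W & P (symdiff Z [set w; v])) ->
  has_excluded_minor S.
Proof.
move=> sDS P0 PD uD noP minP.
have sub_lt (Z : {set T}) : Z \subset D -> Z != D -> #|Z| < #|D|.
  by move=> sZD neZD; rewrite proper_card // properEneq neZD.
(* Exchange from the empty displacement towards [Z], which is closer than [D]. *)
have from0 (Z : {set T}) w : Z \subset D -> P Z -> Z != D -> w \in Z ->
    exists2 v, v \in Z & P [set w; v].
  move=> sZD PZ neZD; have := minP set0 Z w P0 PZ.
  by rewrite symdiffC symdiff0 => /(_ (sub_lt _ sZD neZD)) ex /ex[v vZ];
    rewrite symdiffC symdiff0; exists v.
(* Otherwise [from0] at [u] would give a feasible [{u, v}] with [v] in [D], against [noP]. *)
have fullP (Z : {set T}) : Z \subset D -> P Z -> u \in Z -> Z = D.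
  move=> sZD PZ uZ; apply/eqP; case: eqVneq => // neZD.
  have [v vZ] := from0 _ _ sZD PZ neZD uZ.
  by apply/contraLR => _; apply/noP/(subsetP sZD).
(* Exchange from [Z] towards [D] at [u]: the result contains [u], so it is all of [D] by [fullP].
   The case [v = u] is possible. *)
have toD (Z : {set T}) : Z \subset D -> P Z -> Z != set0 -> Z != D ->
    exists2 v, v \in D :\: Z & D = u |: (v |: Z).
  move=> sZD PZ neZ0 neZD.
  have uZ : u \notin Z by apply: contra neZD => uZ; apply/eqP/fullP.
  have dE : symdiff Z D = D :\: Z.
    rewrite /symdiff (_ : Z :\: D = set0) ?set0U //.
    by apply/eqP; rewrite setD_eq0.
  have [||v] := minP Z D u PZ PD.
  - rewrite dE cardsD (setIidPr sZD) ltn_subrL.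
    by rewrite !card_gt0 neZ0; apply/set0Pn; exists u.
  - by rewrite dE inE uZ.
  rewrite dE => vDZ; have [vD vZ] := setDP vDZ.
  have -> : symdiff Z [set u; v] = u |: (v |: Z).
    apply/setP=> x; rewrite in_symdiff !inE.
    case: (x =P u) => [->|_]; first by rewrite (negPf uZ).
    case: (x =P v) => [->|_]; first by rewrite (negPf vZ).
    by rewrite addbF.
  move=> /fullP eqD; exists v; rewrite // eqD ?setU11 //.
  by rewrite !subUset !sub1set uD vD.
have P1 : ~~ P [set u] by rewrite -[[set u]]setUid noP.
have [noZ|] := boolP [forall Z : {set T},
    (Z \subset D) && P Z ==> (Z == set0) || (Z == D)].
  apply: (@only_two_feasible T S X D) => // [|Z sZD].
    (* With at most two elements, [D] would be [{u, v}] for some [v], possibly [u] itself, against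
       [noP]. *)
    rewrite ltnNge; apply: contraL PD => leD2.
    have [/eqP|[v]] := set_0Vmem (D :\ u).
      rewrite setD_eq0 => sDu; suff -> : D = [set u] by [].
      by apply/eqP; rewrite eqEsubset sDu sub1set.
    rewrite !inE => /andP[neqvu vD].
    suff <- : [set u; v] = D by apply: noP.
    apply/eqP; rewrite eqEcard subUset !sub1set uD vD /=.
    by rewrite cards2 eq_sym neqvu.
  apply/idP/orP => [PZ|[/eqP->|/eqP->] //].
  by apply/orP; apply: (implyP (forallP noZ Z)); apply/andP.
case/forallPn => Z; rewrite negb_imply negb_or.
case/andP => /andP[sZD PZ] /andP[neZ0 neZD].
have uZ : u \notin Z by apply: contra neZD => uZ; apply/eqP/fullP.
(* A further feasible [Z] yields a feasible [{w, w'}] by [from0], and then [toD] gives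
   [D = {u, v, w, w'}]. The cases are the possible coincidences [w = w'] and [u = v]; having both
   would contradict [noP]. *)
have [w wZ] := set0Pn _ neZ0.
have [w' w'Z Pww'] := from0 _ _ sZD PZ neZD wZ.
have sww' : [set w; w'] \subset Z by rewrite subUset !sub1set wZ.
have uww' : u \notin [set w; w'] by apply: contra uZ; apply: subsetP.
have neww' : [set w; w'] != D by apply: contraNneq uww' => ->.
have [||v vDZ defD] := toD _ (subset_trans sww' sZD) Pww'.
- by apply/set0Pn; exists w; rewrite !inE eqxx.
- by [].
move: vDZ; rewrite !inE negb_or => /andP[/andP[nevw nevw'] vD].
move: uww'; rewrite !inE negb_or => /andP[neuw neuw'].
have wD := subsetP sZD _ wZ; have w'D := subsetP sZD _ w'Z.
have DS x : x \in D -> x \in ground S by apply: subsetP.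
have [eqww'|neqww'] := eqVneq w w'.
  subst w'; rewrite setUid in Pww' defD.
  have [equv|nequv] := eqVneq u v.
    by move: PD (noP w wD); rewrite defD -equv setUA setUid => ->.
  apply: (@three_elements T S X u v w); rewrite ?set_cons ?set_nil ?setU0 //.
  - by rewrite /= !inE negb_or nequv neuw nevw.
  - by rewrite /= !DS.
  - by rewrite -defD.
  - exact: noP.
  - exact: noP.
  - by apply/or3P; constructor 2.
have [equv|nequv] := eqVneq u v.
  rewrite -equv setUA setUid in defD.
  apply: (@three_elements T S X u w w'); rewrite ?set_cons ?set_nil ?setU0 //.
  - by rewrite /= !inE negb_or neuw neuw' neqww'.
  - by rewrite /= !DS.
  - by rewrite -defD.
  - exact: noP.
  - exact: noP.
  - by apply/or3P; constructor 3.
have uniq_s : uniq [:: u; w; w'; v].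
  by rewrite /= !inE !negb_or neuw neuw' nequv neqww' eq_sym nevw eq_sym nevw'.
have defD' : D = [set:: [:: u; w; w'; v]].
  rewrite defD; apply/setP=> x; rewrite !inE.
  by case: (x == u); case: (x == w); case: (x == w'); case: (x == v).
have cardD : #|D| = 4 by rewrite defD' cardsE (card_uniqP uniq_s).
(* A feasible singleton would leave [D] with at most three elements by [toD]. *)
have noP1 x : x \in D -> ~~ P [set x].
  move=> xD; apply/negP => Px.
  have le_card (y z : T) : #|y |: (z |: [set x])| <= 3.
    by rewrite !cardsU1 cards1; do 2!case: (_ \notin _).
  have [||||y _ Dy] := toD [set x].
  - by rewrite sub1set.
  - by [].
  - by apply/set0Pn; exists x; rewrite inE.
  - by apply/eqP => Dx; move: cardD; rewrite -Dx cards1.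
  - by have := le_card u y; rewrite -Dy cardD.
have noP3 x y : x \in D -> y \in D -> ~~ P [set:: [:: u; x; y]].
  move=> xD yD; apply/negP => /fullP eqD.
  have : #|[set:: [:: u; x; y]]| <= 3.
    by rewrite cardsE (leq_trans (card_size _)).
  rewrite eqD ?cardD //; last by rewrite !inE eqxx.
  by apply/subsetP => z; rewrite !inE => /or3P[]/eqP->.
(* Exchange from the triple towards the empty set at [x], at distance 3 below 4. Removing a second
   element would leave a singleton, so only [x] is removed. *)
have pairs x y z : uniq [:: x; y; z] -> x \in D -> y \in D -> z \in D ->
    P [set:: [:: x; y; z]] -> P [set:: [:: y; z]].
  move=> /= /and3P[]; rewrite !inE negb_or.
  move=> /andP[/negPf xy /negPf xz] /negPf yz _.
  move=> xD yD zD Pxyz; have [|| t] := minP _ _ x Pxyz P0.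
  - by rewrite symdiff0 cardD ltnS cardsE card_size.
  - by rewrite symdiff0 !inE eqxx.
  have neqs := (xy, xz, yz, eq_sym y x, eq_sym z x, eq_sym z y).
  rewrite symdiff0 !inE => /or3P[]/eqP ->.
  - suff -> : symdiff [set:: [:: x; y; z]] [set x; x] = [set:: [:: y; z]] by [].
    apply/setP=> a; rewrite in_symdiff !inE.
    case: (a =P x) => [->|_]; [|case: (a =P y) => [->|_];
      [|case: (a =P z) => _]]; by rewrite ?neqs ?eqxx.
  - suff -> : symdiff [set:: [:: x; y; z]] [set x; y] = [set z].
      by rewrite (negPf (noP1 z zD)).
    apply/setP=> a; rewrite in_symdiff !inE.
    case: (a =P x) => [->|_]; [|case: (a =P y) => [->|_];
      [|case: (a =P z) => _]]; by rewrite ?neqs ?eqxx.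
  - suff -> : symdiff [set:: [:: x; y; z]] [set x; z] = [set y].
      by rewrite (negPf (noP1 y yD)).
    apply/setP=> a; rewrite in_symdiff !inE.
    case: (a =P x) => [->|_]; [|case: (a =P y) => [->|_];
      [|case: (a =P z) => _]]; by rewrite ?neqs ?eqxx.
apply: (@four_elements T S X u w w' v) => //; rewrite -1?defD' //.
- by rewrite /= !DS.
- by rewrite set_cons set_nil setU0.
- by rewrite !set_cons set_nil setU0; apply: noP.
- by rewrite !set_cons set_nil setU0; apply: noP.
- by rewrite !set_cons set_nil setU0; apply: noP.
- exact: noP3.
- exact: noP3.
- exact: noP3.
- by rewrite set_cons set_nil setU0; apply: noP1.
- by rewrite set_cons set_nil setU0; apply: noP1.
- by rewrite set_cons set_nil setU0; apply: noP1.
- by rewrite !set_cons set_nil setU0.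
have uniq3 : uniq [:: w; w'; v] by case/andP: uniq_s.
move=> Pw; apply/andP; split; last exact: (pairs w).
apply: (pairs w') => //; last by rewrite !set_cons setUCA -!set_cons.
by rewrite (uniq_catCA [:: w'] [:: w] [:: v]).
Qed.

(** Failure of exchange is decidable on finite data, so a failing triple with the smallest symmetric
    difference can be selected. *)
Lemma exchange_or_excluded (T : finType) (S : set_system T) :
  exchange S \/ has_excluded_minor S.
Proof.
pose fails (t : {set T} * {set T} * T) :=
  [&& t.1.1 \in feasible S, t.1.2 \in feasible S,
      t.2 \in symdiff t.1.1 t.1.2 &
      [forall v in symdiff t.1.1 t.1.2,
        symdiff t.1.1 [set t.2; v] \notin feasible S]].
have [t0 t0P|no_fail] := pickP fails; last first.
  left=> X Y u XS YS uXY; have /negbT := no_fail (X, Y, u).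
  rewrite /fails /= XS YS uXY /= => /forall_inPn[v vXY /negPn vS].
  by exists v.
right; have [[[X Y] u]] := arg_minnP (fun t => #|symdiff t.1.1 t.1.2|) t0P.
case/and4P => /= XS YS uXY /forall_inP noS minXY.
apply: (@minimal_failure_excluded T S X (symdiff X Y) u) => //.
- by rewrite subUset !(subset_trans (subsetDl _ _)) ?feasible_sub.
- by rewrite symdiff0.
- by rewrite symdiffKl.
(* Shifting both sets by [X] preserves their symmetric difference, so minimality supplies the
   exchange for closer pairs of displacements. *)
move=> Z W w ZS WS ltZW wZW.
have dE : symdiff (symdiff X Z) (symdiff X W) = symdiff Z W.
  by apply/setP=> x; rewrite !in_symdiff; do 3!case: (x \in _).
have := contra (minXY (symdiff X Z, symdiff X W, w)).
rewrite /fails /= dE -ltnNge ZS WS wZW => /(_ ltZW).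
case/forall_inPn => v vZW /negPn vS; exists v => //.
by rewrite symdiffA.
Qed.

Theorem theorem5p1 (T : finType) (S : set_system T) (hS : proper_system S) :
  delta_matroid S <->
  ~ exists (N : set_system T) (n : nat) (M : set_system 'I_n),
      [/\ minor S N, in_calS M \/ in_calT M & isomorphic N M].
Proof.
split=> [[_ exS]|no_excluded]; first exact: exchange_no_excluded_minor.
by split=> //; case: (exchange_or_excluded S).
Qed.
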